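(* If $(X,d)$ is a (metric) subspace of a $\mathrm{CAT}(0)$-space, then $C_0(X,d)\leq\sqrt{2}$.
   Context: For a metric space $(X,d)$ and $\mu \geq 0$, say that $(X,d)$ satisfies the $(\mu,0)$-four-point inequality if for all $x,y,z,w\in X$, $d(x,y)+d(z,w)\le \mu\max\{d(x,z)+d(y,w),\ d(x,w)+d(y,z)\}$. The quadrilateral constant of $(X,d)$ is $C_0(X,d)=\inf\{\mu\geq 0 \mid (X,d)\text{ satisfies the }(\mu,0)\text{-four-point inequality}\}$. A $\mathrm{CAT}(0)$-space is a geodesic metric space in which, for every geodesic triangle, the distance between any two points of the triangle is at most the Euclidean distance between the corresponding points of a comparison triangle in the Euclidean plane. *)

(* Defs.v *)
From HB Require Import structures.
From mathcomp Require Import all_boot all_order all_algebra.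
From mathcomp Require Import boolp classical_sets reals topology.
From mathcomp Require Import metric_structure.
From mathcomp Require Import lra.

Set Implicit Arguments.
Unset Strict Implicit.
Unset Printing Implicit Defensive.

Import Order.TTheory GRing.Theory Num.Theory.

Local Open Scope classical_set_scope.
Local Open Scope ring_scope.

Section MetricSub.
Context {R : realType} {Y : metricType R} (A : set Y).

(* An alias of the subtype of elements of A, carrying the restricted distance;
   the alias keeps this structure apart from the library's instances on
   set_type. *)
Definition metric_sub : Type := set_type A.

HB.instance Definition _ := Choice.on metric_sub.

Definition sub_dist (x y : metric_sub) : R := mdist (\val x) (\val y).

Lemma sub_distxx x : sub_dist x x = 0.
Proof. exact: mdistxx. Qed.

Lemma sub_dist_positivity x y : sub_dist x y = 0 -> x = y.
Proof. by move=> /mdist_positivity/val_inj. Qed.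

Lemma sub_dist_sym x y : sub_dist x y = sub_dist y x.
Proof. exact: metric_sym. Qed.

Lemma sub_dist_triangle y x z : sub_dist x z <= sub_dist x y + sub_dist y z.
Proof. exact: metric_triangle. Qed.

HB.instance Definition _ := isMetric.Build R metric_sub
  sub_distxx sub_dist_positivity sub_dist_sym sub_dist_triangle.

Lemma metric_sub_distE (x y : metric_sub) :
  mdist x y = mdist (\val x) (\val y).
Proof. by []. Qed.

End MetricSub.

Section QuadrilateralConstant.
Context {R : realType} (X : metricType R).

Definition four_point_inequality (mu : R) : Prop :=
  forall x y z w : X,
    mdist x y + mdist z w
    <= mu * Num.max (mdist x z + mdist y w) (mdist x w + mdist y z).

Definition quadrilateral_constant : R :=
  inf [set mu : R | 0 <= mu /\ four_point_inequality mu].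

(* On reals, inf has a default value outside has_inf. *)
Lemma has_inf_four_point :
  has_inf [set mu : R | 0 <= mu /\ four_point_inequality mu].
Proof.
split; last by exists 0 => mu [].
exists 2; split; first exact: ler0n.
move=> x y z w.
set a := mdist x z + _; set b := mdist x w + _.
have le_a : a <= Num.max a b by rewrite le_max lexx.
have le_b : b <= Num.max a b by rewrite le_max lexx orbT.
rewrite mulr_natl mulr2n; apply: le_trans (lerD le_a le_b).
rewrite -(@ler_pM2r _ 2) ?ltr0n// !mulr_natr !mulr2n /a /b.
have xzy := metric_triangle x z y; have xwy := metric_triangle x w y.
have zxw := metric_triangle z x w; have zyw := metric_triangle z y w.
apply: le_trans (lerD (lerD xzy zxw) (lerD xwy zyw)) _.
by rewrite (metric_sym z y) (metric_sym w y) (metric_sym z x); lra.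
Qed.

End QuadrilateralConstant.

Section CAT0.
Context {R : realType} (X : metricType R).

(* Geodesics are parametrized by arc length; only the values of c on
   [0, mdist x y] matter. *)
Definition geodesic (x y : X) (c : R -> X) : Prop :=
  [/\ c 0 = x, c (mdist x y) = y &
      forall s t, 0 <= s <= mdist x y -> 0 <= t <= mdist x y ->
        mdist (c s) (c t) = `|s - t|].

Definition geodesic_space : Prop :=
  forall x y : X, exists c, geodesic x y c.

(* The library norm on row vectors is the sup norm, hence this definition. *)
Definition euclid_dist (u v : 'rV[R]_2) : R :=
  Num.sqrt (\sum_(i < 2) (u 0 i - v 0 i) ^+ 2).

Definition comparison_triangle (x y z : X) (u v w : 'rV[R]_2) : Prop :=
  [/\ euclid_dist u v = mdist x y, euclid_dist v w = mdist y z &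
      euclid_dist w u = mdist z x].

(* p lies on the geodesic side c from x to y, and p' is the point of the
   Euclidean segment [u, v] at the same distance from u as p from x. *)
Definition comparison_point (x y : X) (c : R -> X) (u v : 'rV[R]_2)
    (p : X) (p' : 'rV[R]_2) : Prop :=
  [/\ exists2 t, 0 <= t <= mdist x y & p = c t,
      exists2 s : R, 0 <= s <= 1 & p' = (1 - s) *: u + s *: v &
      euclid_dist u p' = mdist x p].

(* A point lying on several sides of the triangle may have several comparison
   points; the inequality is required for all of them. *)
Definition CAT0_inequality : Prop :=
  forall (x y z : X) (a b c : R -> X) (u v w : 'rV[R]_2),
    geodesic x y a -> geodesic y z b -> geodesic z x c ->
    comparison_triangle x y z u v w ->
    let corresponding p p' :=
      [\/ comparison_point x y a u v p p', comparison_point y z b v w p p' |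
          comparison_point z x c w u p p'] in
    forall (p q : X) (p' q' : 'rV[R]_2),
      corresponding p p' -> corresponding q q' ->
      mdist p q <= euclid_dist p' q'.

Definition CAT0_space : Prop := geodesic_space /\ CAT0_inequality.

End CAT0.

(* Main.v *)
Require Import Defs.
From mathcomp Require Import all_boot all_order all_algebra.
From mathcomp Require Import boolp classical_sets reals topology.
From mathcomp Require Import metric_structure.
From mathcomp Require Import ring lra.

(** Let x, z, y, w be the consecutive vertices of a quadrilateral in a CAT(0)
    space, with sides a = xz, b = zy, c = yw, e = wx and diagonals p = xy,
    q = zw.  Everything rests on the inequality of Berg and Nikolaev
      p^2 + q^2 <= a^2 + c^2 + 2 b e                       [CAT0_quadrilateral].
    Exchanging the two pairs of opposite sides and averaging gives
      p^2 + q^2 <= ((a + c)^2 + (b + e)^2) / 2 <= max(a + c, b + e)^2,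
    and (p + q)^2 <= 2 (p^2 + q^2) then produces the constant sqrt 2.  Only
    distances between the four points occur, so the bound passes to subspaces.

    For the quadrilateral inequality, take a point m at parameter l on the
    diagonal from x to y.  Comparison with the Euclidean plane, where Stewart's
    identity holds, bounds zm^2 and mw^2 from above [CAT0_stewart].  In the
    triangle inequality q <= zm + mw, convexity of the square with weights 1 - l
    and l gives q^2 <= zm^2 / (1 - l) + mw^2 / l [sqrD_le_weighted].  Then a^2,
    c^2 and p^2 get total coefficients free of l, and l = e / (b + e) optimizes
    what remains. *)

Import Order.TTheory GRing.Theory Num.Theory.

Local Open Scope classical_set_scope.
Local Open Scope ring_scope.

(** * Real inequalities *)

(** The convexity of squaring, in the form (s + t)^2 <= s^2 / (1 - l) + t^2 / l
    with the denominators cleared. *)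
Lemma sqrD_le_weighted (R : realFieldType) (l s t : R) :
  l * (1 - l) * (s + t) ^+ 2 <= l * s ^+ 2 + (1 - l) * t ^+ 2.
Proof.
rewrite -subr_ge0.
have -> : l * s ^+ 2 + (1 - l) * t ^+ 2 - l * (1 - l) * (s + t) ^+ 2
  = (l * s - (1 - l) * t) ^+ 2 by ring.
exact: sqr_ge0.
Qed.

Lemma sumr_le_sqrt2_max (R : rcfType) (p q s t : R) :
    0 <= s -> 0 <= t -> p ^+ 2 + q ^+ 2 <= (s ^+ 2 + t ^+ 2) / 2 ->
  p + q <= Num.sqrt 2 * Num.max s t.
Proof.
move=> s0 t0 le_pq; set M := Num.max s t.
have sM : s <= M by rewrite le_max lexx.
have tM : t <= M by rewrite le_max lexx orbT.
have M0 : 0 <= M by apply: le_trans sM.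
have sqrt2M0 : 0 <= Num.sqrt 2 * M by rewrite mulr_ge0 ?sqrtr_ge0.
apply: le_trans (ler_norm _) _.
rewrite -ler_sqr ?nnegrE// real_normK ?num_real// exprMn sqr_sqrtr ?ler0n//.
have ssM : s ^+ 2 <= M ^+ 2 by rewrite ler_sqr.
have ttM : t ^+ 2 <= M ^+ 2 by rewrite ler_sqr.
have := sqr_ge0 (p - q).
by nra.
Qed.

(** * Euclidean comparison triangles *)

Section EuclideanPlane.
Context {R : realType}.
Implicit Types u v w : 'rV[R]_2.

Lemma euclid_dist_ge0 u v : 0 <= euclid_dist u v.
Proof. exact: sqrtr_ge0. Qed.

Lemma sqr_euclid_dist u v :
  euclid_dist u v ^+ 2 = (u 0 0 - v 0 0) ^+ 2 + (u 0 1 - v 0 1) ^+ 2.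
Proof.
rewrite sqr_sqrtr; last by apply: sumr_ge0 => i _; exact: sqr_ge0.
rewrite big_ord_recl big_ord1.
by congr ((u 0 _ - v 0 _) ^+ 2 + (u 0 _ - v 0 _) ^+ 2); apply: val_inj.
Qed.

Lemma euclid_dist_eq u v (r : R) :
    0 <= r -> (u 0 0 - v 0 0) ^+ 2 + (u 0 1 - v 0 1) ^+ 2 = r ^+ 2 ->
  euclid_dist u v = r.
Proof.
move=> r0 uvr; apply/eqP; rewrite -(@eqrXn2 _ 2) ?euclid_dist_ge0//.
by rewrite sqr_euclid_dist uvr.
Qed.

Lemma euclid_dist_convl u v (l : R) : 0 <= l ->
  euclid_dist u ((1 - l) *: u + l *: v) = l * euclid_dist u v.
Proof.
move=> l0; apply: euclid_dist_eq; first by rewrite mulr_ge0 ?euclid_dist_ge0.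
by rewrite exprMn sqr_euclid_dist !mxE; ring.
Qed.

Lemma euclid_stewart u v w (l : R) :
  euclid_dist ((1 - l) *: u + l *: v) w ^+ 2
  = (1 - l) * euclid_dist w u ^+ 2 + l * euclid_dist v w ^+ 2
    - l * (1 - l) * euclid_dist u v ^+ 2.
Proof. by rewrite !sqr_euclid_dist !mxE; ring. Qed.

(** The first side is laid on the horizontal axis from the origin; the law of
    cosines then gives the abscissa h of the third vertex, and the triangle
    inequalities say exactly that h^2 does not exceed t^2. *)
Lemma euclid_triangle_exists (r s t : R) :
    0 <= r -> 0 <= s -> 0 <= t ->
    r <= s + t -> s <= r + t -> t <= r + s ->
  exists u v w,
    [/\ euclid_dist u v = r, euclid_dist v w = s & euclid_dist w u = t].
Proof.
move=> r0 s0 t0 r_st s_rt t_rs.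
pose pt (x y : R) : 'rV[R]_2 := \row_(i < 2) (if i == 0 then x else y).
have [r_eq0|r_neq0] := eqVneq r 0.
  have ts : t = s by lra.
  exists (pt 0 0), (pt 0 0), (pt s 0).
  by split; apply: euclid_dist_eq => //; rewrite !mxE /= ?r_eq0 ?ts; ring.
pose h := (t ^+ 2 + r ^+ 2 - s ^+ 2) / (2 * r).
have hE : 2 * r * h = t ^+ 2 + r ^+ 2 - s ^+ 2 by rewrite /h; field.
have r_gt0 : 0 < r by rewrite lt_def r_neq0.
have h_le : h <= t.
  rewrite -(@ler_pM2l _ (2 * r)) ?mulr_gt0// hE -subr_ge0.
  have -> : 2 * r * t - (t ^+ 2 + r ^+ 2 - s ^+ 2)
    = (s - (r - t)) * (s + (r - t)) by ring.
  by apply: mulr_ge0; lra.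
have h_ge : - t <= h.
  rewrite -(@ler_pM2l _ (2 * r)) ?mulr_gt0// hE -subr_ge0.
  have -> : t ^+ 2 + r ^+ 2 - s ^+ 2 - 2 * r * - t
    = (r + t - s) * (r + t + s) by ring.
  by apply: mulr_ge0; lra.
have k0 : 0 <= t ^+ 2 - h ^+ 2.
  by rewrite subr_sqr; apply: mulr_ge0; lra.
exists (pt 0 0), (pt r 0), (pt h (Num.sqrt (t ^+ 2 - h ^+ 2))).
split; apply: euclid_dist_eq => //; rewrite !mxE /=.
- by ring.
- rewrite sub0r sqrrN sqr_sqrtr//.
  have -> : (r - h) ^+ 2 + (t ^+ 2 - h ^+ 2) = r ^+ 2 - 2 * r * h + t ^+ 2.
    by ring.
  by rewrite hE; ring.
- by rewrite !subr0 sqr_sqrtr//; ring.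
Qed.

End EuclideanPlane.

(** * Quadrilaterals in CAT(0) spaces *)

Section CAT0Quadrilateral.
Context {R : realType} {Y : metricType R}.
Hypothesis hY : CAT0_space Y.

(** Stewart's identity becomes an inequality, because the CAT(0) condition
    bounds the distance from z to m by its Euclidean counterpart. *)
Lemma CAT0_stewart (x y : Y) (l : R) : 0 <= l <= 1 ->
  exists m : Y, forall z : Y,
    mdist m z ^+ 2
    <= (1 - l) * mdist x z ^+ 2 + l * mdist y z ^+ 2
       - l * (1 - l) * mdist x y ^+ 2.
Proof.
move=> /andP[l0 l1]; have [geoY catY] := hY.
have [a ga] := geoY x y.
have d0 : 0 <= mdist x y by exact: mdist_ge0.
have ld : 0 <= l * mdist x y <= mdist x y.
  by rewrite mulr_ge0//= ler_piMl.
exists (a (l * mdist x y)) => z.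
have [b gb] := geoY y z; have [c gc] := geoY z x.
have [||||||u [v [w [uv vw wu]]]] :=
  @euclid_triangle_exists R (mdist x y) (mdist y z) (mdist z x).
- exact: mdist_ge0.
- exact: mdist_ge0.
- exact: mdist_ge0.
- by rewrite addrC (metric_sym z x) (metric_sym y z); exact: metric_triangle.
- by rewrite (metric_sym x y) (metric_sym z x); exact: metric_triangle.
- by rewrite addrC (metric_sym y z) (metric_sym x y); exact: metric_triangle.
(* Both m and the apex z lie on sides of the triangle: z as the start of the
   side from z to x. *)
have le_mz : mdist (a (l * mdist x y)) z
             <= euclid_dist ((1 - l) *: u + l *: v) w.
  apply: (catY x y z a b c u v w) => //.
    apply: Or31; split.
    - by exists (l * mdist x y).
    - by exists l; rewrite ?l0.
    - have [a0 _ aE] := ga.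
      have := aE 0 (l * mdist x y); rewrite a0 lexx => -> //.
      by rewrite euclid_dist_convl// uv sub0r normrN ger0_norm// mulr_ge0.
  apply: Or33; split.
  - by exists 0; rewrite ?lexx ?mdist_ge0//; case: gc.
  - by exists 0; rewrite ?lexx ?ler01// subr0 scale1r scale0r addr0.
  - by rewrite mdistxx; apply: euclid_dist_eq => //; ring.
rewrite (metric_sym x z) -vw -wu -{2}uv -euclid_stewart.
by rewrite ler_sqr ?nnegrE ?mdist_ge0 ?euclid_dist_ge0.
Qed.

(** A broken path z, m, w is never shorter than zw, and every point m of the
    diagonal xy bounds zw this way; the best m divides xy in the ratio of the
    opposite sides xw and yz, whence their product on the right. *)
Lemma CAT0_quadrilateral (x y z w : Y) :
  mdist x y ^+ 2 + mdist z w ^+ 2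
  <= mdist x z ^+ 2 + mdist y w ^+ 2 + 2 * (mdist x w * mdist y z).
Proof.
(* When xw or yz vanishes, the ratio l degenerates, but so does the
   quadrilateral: two of its vertices coincide. *)
have [xw0|e_neq0] := eqVneq (mdist x w) 0.
  rewrite (mdist_positivity _ _ xw0) mdistxx (metric_sym w y) (metric_sym w z).
  by lra.
have [yz0|b_neq0] := eqVneq (mdist y z) 0.
  by rewrite (mdist_positivity _ _ yz0) mdistxx; lra.
have e_gt0 : 0 < mdist x w by rewrite lt_def e_neq0 mdist_ge0.
have b_gt0 : 0 < mdist y z by rewrite lt_def b_neq0 mdist_ge0.
have be_gt0 : 0 < mdist y z + mdist x w by rewrite addr_gt0.
pose l := mdist x w / (mdist y z + mdist x w).
have l_gt0 : 0 < l by rewrite divr_gt0.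
have lC : 1 - l = mdist y z / (mdist y z + mdist x w).
  by rewrite /l; field; rewrite gt_eqF.
have lC_gt0 : 0 < 1 - l by rewrite lC divr_gt0.
have [|m mP] := @CAT0_stewart x y l; first by rewrite !ltW//= -subr_gt0.
have zm := mP z; have wm := mP w.
have zw : mdist z w <= mdist m z + mdist m w.
  by rewrite (metric_sym m z); exact: metric_triangle.
have zw2 : mdist z w ^+ 2 <= (mdist m z + mdist m w) ^+ 2.
  by rewrite ler_sqr ?nnegrE ?addr_ge0 ?mdist_ge0.
have ll_gt0 : 0 < l * (1 - l) by rewrite mulr_gt0.
have weighted := @sqrD_le_weighted R l (mdist m z) (mdist m w).
(* The choice of l makes both mixed terms proportional to the product be. *)
have mixed : l ^+ 2 * mdist y z ^+ 2 + (1 - l) ^+ 2 * mdist x w ^+ 2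
             = l * (1 - l) * (2 * (mdist x w * mdist y z)).
  by rewrite lC /l; field; rewrite gt_eqF.
rewrite -(ler_pM2l ll_gt0) [leRHS]mulrDr -mixed.
have zw3 := ler_wpM2l (ltW ll_gt0) zw2.
have zm2 := ler_wpM2l (ltW l_gt0) zm.
have wm2 := ler_wpM2l (ltW lC_gt0) wm.
move: zw3 zm2 wm2 weighted; clear.
by move: (mdist m z) (mdist m w) l => ? ? ?; lra.
Qed.

Lemma CAT0_four_point (x y z w : Y) :
  mdist x y + mdist z w
  <= Num.sqrt 2 * Num.max (mdist x z + mdist y w) (mdist x w + mdist y z).
Proof.
apply: sumr_le_sqrt2_max; rewrite ?addr_ge0 ?mdist_ge0//.
have := CAT0_quadrilateral x y z w; have := CAT0_quadrilateral x y w z.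
by rewrite (metric_sym w z); lra.
Qed.

End CAT0Quadrilateral.

Theorem corollary4p3 (R : realType) (Y : metricType R) (hY : CAT0_space Y)
    (A : set Y) :
  quadrilateral_constant (metric_sub A) <= Num.sqrt (2 : R).
Proof.
apply: ge_inf; first by case: (has_inf_four_point (metric_sub A)).
split; first exact: sqrtr_ge0.
by move=> x y z w; rewrite !metric_sub_distE; exact: CAT0_four_point.
Qed.
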